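(* Let $G\curvearrowright X$ and $H\curvearrowright Y$ be partial dynamical systems. The following are equivalent: (1) $G\curvearrowright X$ and $H\curvearrowright Y$ are isomorphic in $\mathrm{PDynSys}_{\mathrm{Orb}}$. (2) $G\ltimes X$ and $H\ltimes Y$ are isomorphic as topological groupoids. (3) There exists a continuous orbit equivalence $(\phi,a,b)$ between $G\curvearrowright X$ and $H\curvearrowright Y$ such that $a$ is a cocycle and $(\phi,a)$ preserves stabilisers. (4) There exists a continuous orbit equivalence $(\phi,a,b)$ between $G\curvearrowright X$ and $H\curvearrowright Y$ such that $a$ is a cocycle and $(\phi,a)$ preserves essential stabilisers.
   Context: All groups are discrete and countable; all topological spaces are locally compact, Hausdorff and second-countable. A partial action of a group $G$ (identity $e_G$) on a space $X$ consists of open subsets $\{U_g\}_{g\in G}$ of $X$ and homeomorphisms $\varphi_g:U_{g^{-1}}\to U_g$, $x\mapsto g.x$, such that (i) $U_{e_G}=X$ and $\varphi_{e_G}=\mathrm{id}_X$; (ii) $g_2.(U_{(g_1g_2)^{-1}}\cap U_{g_2^{-1}})=U_{g_2}\cap U_{g_1^{-1}}$ for all $g_1,g_2\in G$, and $(g_1g_2).x=g_1.(g_2.x)$ for all $x\in U_{g_2^{-1}}\cap U_{(g_1g_2)^{-1}}$. The triple $(X,G,\varphi)$ is a partial dynamical system, written $G\curvearrowright X$. For $H\curvearrowright Y$ the corresponding open sets are denoted $V_h$. The transformation groupoid is $G\ltimes X=\{(g,x)\in G\times X: x\in U_{g^{-1}}\}$ with the subspace topology from $G\times X$, $s(g,x)=x$,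 $r(g,x)=g.x$, $(g_1,g_2.x)(g_2,x)=(g_1g_2,x)$, $(g,x)^{-1}=(g^{-1},g.x)$. A map $a:\bigcup_{g\in G}\{g\}\times U_{g^{-1}}\to H$ is a cocycle if $a(g_1g_2,x)=a(g_1,g_2.x)a(g_2,x)$ for all $g_1,g_2\in G$ and $x\in U_{g_2^{-1}}\cap U_{(g_1g_2)^{-1}}$. An orbit morphism $G\curvearrowright X\to H\curvearrowright Y$ is a pair $(\phi,a)$ of continuous maps $\phi:X\to Y$ and $a:\bigcup_{g\in G}\{g\}\times U_{g^{-1}}\to H$ such that $a$ is a cocycle and, for all $g\in G$, $x\in U_{g^{-1}}$, $\phi(x)\in V_{a(g,x)^{-1}}$ and $\phi(g.x)=a(g,x).\phi(x)$. Composition is $(\psi,b)\circ(\phi,a)=(\psi\circ\phi,c)$ with $c(g,x)=b(a(g,x),\phi(x))$, and the identity of $G\curvearrowright X$ is $(\mathrm{id}_X,i)$ with $i(g,x)=g$. $\mathrm{PDynSys}_{\mathrm{Orb}}$ is the resulting category. A continuous orbit equivalence $(\phi,a,b)$ between $G\curvearrowright X$ and $H\curvearrowright Y$ consists of a homeomorphism $\phi:X\to Y$ and continuous maps $a:\bigcup_{g\in G}\{g\}\times U_{g^{-1}}\to H$, $b:\bigcup_{h\in H}\{h\}\times V_{h^{-1}}\to G$ such that $\phi(g.x)=a(g,x).\phi(x)$ for all $g\in G,x\in U_{g^{-1}}$ and $\phi^{-1}(h.y)=b(h,y).\phi^{-1}(y)$ for all $h\in H,y\in V_{h^{-1}}$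 (it is part of the requirement that the right-hand sides are defined, i.e. $\phi(x)\in V_{a(g,x)^{-1}}$ and $\phi^{-1}(y)\in U_{b(h,y)^{-1}}$). $\operatorname{Stab}(x)=\{g\in G:x\in U_{g^{-1}},\ g.x=x\}$ and $\operatorname{Stab}^{ess}(x)=\{g\in G: g\in\operatorname{Stab}(y)\text{ for all }y\text{ in some neighborhood of }x\}$ are subgroups of $G$; similarly for points of $Y$. $(\phi,a)$ preserves stabilisers if for every $x\in X$ the map $a(\cdot,x)$ restricts to a bijection $\operatorname{Stab}(x)\to\operatorname{Stab}(\phi(x))$; it preserves essential stabilisers if for every $x\in X$ the map $a(\cdot,x)$ restricts to a bijection $\operatorname{Stab}^{ess}(x)\to\operatorname{Stab}^{ess}(\phi(x))$. *)

(* Defs.v *)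
From HB Require Import structures.
From mathcomp Require Import all_boot all_classical.
From mathcomp Require Import topology.

Set Implicit Arguments.
Unset Strict Implicit.
Unset Printing Implicit Defensive.

Local Open Scope classical_set_scope.
Local Open Scope group_scope.

Record category := Category {
  obj : Type;
  hom : obj -> obj -> Type;
  idn : forall A, hom A A;
  cmp : forall A B C, hom B C -> hom A B -> hom A C;
  cmp_idl : forall A B (f : hom A B), cmp (idn B) f = f;
  cmp_idr : forall A B (f : hom A B), cmp f (idn A) = f;
  cmpA : forall A B C D (f : hom C D) (g : hom B C) (h : hom A B),
    cmp f (cmp g h) = cmp (cmp f g) h
}.

Definition isomorphic (K : category) (A B : obj K) : Prop :=
  exists (f : hom A B) (g : hom B A), cmp g f = idn A /\ cmp f g = idn B.

(* The unit space is a separate type of objects; since [gsrc] is a continuous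
   retraction of the continuous map [gid], it carries the subspace topology of
   the space of units.
   [gcomp (g1, g2)] is the product g1 g2, defined when s(g1) = r(g2). *)
Record topgpd := TopGpd {
  gob : topologicalType;
  garr : topologicalType;
  gsrc : garr -> gob;
  gtgt : garr -> gob;
  gid : gob -> garr;
  ginv : garr -> garr;
  gcomp : [set p : garr * garr | gsrc p.1 = gtgt p.2] -> garr;
  gmul := fun g1 g2 (e : gsrc g1 = gtgt g2) =>
    gcomp (exist _ (g1, g2) (mem_set e));
  gsrc_continuous : continuous gsrc;
  gtgt_continuous : continuous gtgt;
  gid_continuous : continuous gid;
  ginv_continuous : continuous ginv;
  gcomp_continuous : continuous gcomp;
  gsrc_id : forall x, gsrc (gid x) = x;
  gtgt_id : forall x, gtgt (gid x) = x;
  gsrc_inv : forall g, gsrc (ginv g) = gtgt g;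
  gtgt_inv : forall g, gtgt (ginv g) = gsrc g;
  gsrc_mul : forall g1 g2 e, gsrc (@gmul g1 g2 e) = gsrc g2;
  gtgt_mul : forall g1 g2 e, gtgt (@gmul g1 g2 e) = gtgt g1;
  gmulA : forall g1 g2 g3 e12 e23 e1 e3,
    @gmul g1 (@gmul g2 g3 e23) e1 = @gmul (@gmul g1 g2 e12) g3 e3;
  gmul_idl : forall g e, @gmul (gid (gtgt g)) g e = g;
  gmul_idr : forall g e, @gmul g (gid (gsrc g)) e = g;
  gmul_invl : forall g e, @gmul (ginv g) g e = gid (gsrc g);
  gmul_invr : forall g e, @gmul g (ginv g) e = gid (gtgt g)
}.

(* Preservation of units and inverses by a functor follows from [fun_mul]. *)
Record gpd_functor (A B : topgpd) := GpdFunctor {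
  fun_ob : gob A -> gob B;
  fun_arr : garr A -> garr B;
  fun_ob_continuous : continuous fun_ob;
  fun_arr_continuous : continuous fun_arr;
  fun_src : forall g, gsrc (fun_arr g) = fun_ob (gsrc g);
  fun_tgt : forall g, gtgt (fun_arr g) = fun_ob (gtgt g);
  fun_mul : forall g1 g2 (e : gsrc g1 = gtgt g2)
      (e' : gsrc (fun_arr g1) = gtgt (fun_arr g2)),
    fun_arr (gmul e) = gmul e'
}.

Lemma gpd_functor_eq (A B : topgpd) (F F' : gpd_functor A B) :
  fun_ob F = fun_ob F' -> fun_arr F = fun_arr F' -> F = F'.
Proof.
case: F F' => [o a ? ? ? ? ?] [o' a' ? ? ? ? ?] /= eo ea; subst o' a'.
by congr GpdFunctor; exact: Prop_irrelevance.
Qed.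

Definition gpd_functor_id (A : topgpd) : gpd_functor A A.
Proof.
apply: (@GpdFunctor A A id id) => // [||g1 g2 e e'].
- by move=> x; exact: cvg_id.
- by move=> x; exact: cvg_id.
- by congr gmul; exact: Prop_irrelevance.
Defined.

Definition gpd_functor_comp (A B C : topgpd)
  (F' : gpd_functor B C) (F : gpd_functor A B) : gpd_functor A C.
Proof.
apply: (@GpdFunctor A C (fun_ob F' \o fun_ob F) (fun_arr F' \o fun_arr F)).
- by move=> x; apply: continuous_comp; exact: fun_ob_continuous.
- by move=> x; apply: continuous_comp; exact: fun_arr_continuous.
- by move=> g /=; rewrite !fun_src.
- by move=> g /=; rewrite !fun_tgt.
- move=> g1 g2 e e' /=.
  have e1 : gsrc (fun_arr F g1) = gtgt (fun_arr F g2).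
    by rewrite fun_src fun_tgt e.
  by rewrite (fun_mul e e1) (fun_mul e1 e').
Defined.

Definition TopGpdCat : category.
Proof.
apply: (@Category topgpd gpd_functor gpd_functor_id gpd_functor_comp).
- by move=> A B F; exact: gpd_functor_eq.
- by move=> A B F; exact: gpd_functor_eq.
- by move=> A B C D F F' F''; exact: gpd_functor_eq.
Defined.

Definition homeomorphism_on (X Y : topologicalType) (A : set X) (B : set Y)
    (f : X -> Y) : Prop :=
  exists f' : Y -> X,
    [/\ set_fun A B f, set_fun B A f',
        {in A, cancel f f'}, {in B, cancel f' f} &
        {within A, continuous f} /\ {within B, continuous f'}].

(* [pact g] is only meaningful on [pdom g^-1]; its values elsewhere are never
   used. *)
Record partial_action (G : groupType) (X : topologicalType) := PartialAction {
  pdom : G -> set X;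
  pact : G -> X -> X;
  pdom_open : forall g, open (pdom g);
  pact_homeo : forall g, homeomorphism_on (pdom g^-1) (pdom g) (pact g);
  pdom1 : pdom 1 = setT;
  pact1 : forall x, pact 1 x = x;
  pact_image : forall g1 g2,
    pact g2 @` (pdom (g1 * g2)^-1 `&` pdom g2^-1) = pdom g2 `&` pdom g1^-1;
  pactM : forall g1 g2 x, pdom g2^-1 x -> pdom (g1 * g2)^-1 x ->
    pact (g1 * g2) x = pact g1 (pact g2 x)
}.

Section transformation_groupoid.
Context (G : groupType) (X : topologicalType) (act : partial_action G X).
Local Notation U := (pdom act).
Local Notation "g .: x" := (pact act g x) (at level 35, right associativity).

Lemma pact_codom g x : U g^-1 x -> U g (g .: x).
Proof. by move=> Ux; have [f' [+ _ _ _ _]] := pact_homeo act g; apply. Qed.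

Lemma pact_inj g x y : U g^-1 x -> U g^-1 y -> g .: x = g .: y -> x = y.
Proof.
move=> Ux Uy; have [f' [_ _ K _ _]] := pact_homeo act g.
by move=> e; rewrite -(K x) ?inE // -(K y) ?inE // e.
Qed.

Lemma pact_domM g1 g2 x :
  U g2^-1 x -> U (g1 * g2)^-1 x -> U g1^-1 (g2 .: x).
Proof.
move=> U2 U12; have : (U g2 `&` U g1^-1) (g2 .: x).
  by rewrite -pact_image; exists x.
by case.
Qed.

Lemma pact_domMr g1 g2 x :
  U g2^-1 x -> U g1^-1 (g2 .: x) -> U (g1 * g2)^-1 x.
Proof.
move=> U2 U1; have : (U g2 `&` U g1^-1) (g2 .: x).
  by split=> //; exact: pact_codom.
by rewrite -pact_image => -[y [U12y U2y] /(pact_inj U2y U2) <-].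
Qed.

Lemma pact_domV g x : U g^-1 x -> U (g^-1)^-1 (g .: x).
Proof. by move=> Ux; rewrite invgK; exact: pact_codom. Qed.

Lemma pactK g x : U g^-1 x -> g^-1 .: (g .: x) = x.
Proof.
move=> Ux; rewrite -pactM ?mulVg ?pact1//.
by rewrite invg1 pdom1.
Qed.

Lemma pact_dom1 x : U 1^-1 x.
Proof. by rewrite invg1 pdom1. Qed.

Definition tarrows : set (discrete_topology G * X) :=
  [set p | U (p.1 : G)^-1 p.2].

Definition tarr (g : G) (x : X) (Ux : U g^-1 x) : tarrows :=
  exist _ (g, x) (mem_set (Ux : tarrows (g, x))).

Definition tgrp (c : tarrows) : G := (set_val c).1.
Definition tsrc (c : tarrows) : X := (set_val c).2.
Definition ttgt (c : tarrows) : X := tgrp c .: tsrc c.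

Lemma tarrP (c : tarrows) : U (tgrp c)^-1 (tsrc c).
Proof. by have := set_mem (valP c). Qed.

Lemma tarr_eq (c d : tarrows) : tgrp c = tgrp d -> tsrc c = tsrc d -> c = d.
Proof.
case: c d => [[g x] gx] [[h y] hy]; rewrite /tgrp /tsrc /=.
by move=> gh xy; apply: val_inj; rewrite /= gh xy.
Qed.

Definition tid (x : X) : tarrows := tarr (pact_dom1 x).
Definition tinv (c : tarrows) : tarrows := tarr (pact_domV (tarrP c)).

Lemma tcomp_dom (p : [set p : tarrows * tarrows | tsrc p.1 = ttgt p.2]) :
  U (tgrp (set_val p).1 * tgrp (set_val p).2)^-1 (tsrc (set_val p).2).
Proof.
have e : tsrc (set_val p).1 = ttgt (set_val p).2 := set_mem (valP p).
by apply: pact_domMr; [exact: tarrP|rewrite -/(ttgt _) -e; exact: tarrP].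
Qed.

Definition tcomp p : tarrows := tarr (@tcomp_dom p).

Lemma tsrc_continuous : continuous tsrc.
Proof.
move=> c; apply: (@continuous_comp _ _ _ set_val snd).
  exact: initial_continuous.
exact: cvg_snd.
Qed.

Lemma tgrp_continuous : continuous (tgrp : tarrows -> discrete_topology G).
Proof.
move=> c; apply: (@continuous_comp _ _ _ set_val fst).
  exact: initial_continuous.
exact: cvg_fst.
Qed.

Lemma tsrc_comp_continuous (T : topologicalType) (f : T -> tarrows) :
  continuous f -> continuous (fun t => tsrc (f t)).
Proof.
by move=> cf t; apply: continuous_comp; [exact: cf|exact: tsrc_continuous].
Qed.

Lemma tgrp_comp_continuous (T : topologicalType) (f : T -> tarrows) :
  continuous f -> continuous ((fun t => tgrp (f t)) : T -> discrete_topology G).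
Proof.
move=> cf t; apply: (@continuous_comp _ _ (discrete_topology G) f tgrp).
  exact: cf.
exact: tgrp_continuous.
Qed.

Lemma tgrp_near (c : tarrows) : \forall d \near c, tgrp d = tgrp c.
Proof. exact: (tgrp_continuous (discrete_set1 _)). Qed.

Lemma ttgt_continuous : continuous ttgt.
Proof.
move=> c; have [f' [_ _ _ _ [cf _]]] := pact_homeo act (tgrp c).
have Uc := tarrP c.
move: cf; rewrite continuous_open_subspace; last exact: pdom_open.
move=> /(_ (tsrc c)); rewrite inE => /(_ Uc) cf.
have ct : {for c, continuous (pact act (tgrp c) \o tsrc)}.
  by apply: continuous_comp => //; exact: tsrc_continuous.
move=> W Wc; apply: filterS2 (tgrp_near c) (ct W Wc) => d e.
by rewrite /= /ttgt e.
Qed.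

Lemma tarr_continuous (T : topologicalType) (f : T -> tarrows) :
  continuous (tgrp \o f : T -> discrete_topology G) ->
  continuous (tsrc \o f) -> continuous f.
Proof.
move=> cg cs; apply: continuous_comp_initial => t /=.
rewrite (_ : set_val \o f = fun t => (tgrp (f t), tsrc (f t))); last first.
  by apply/funext => u /=; rewrite /tgrp /tsrc; case: (set_val _).
exact: cvg_pair (cg t) (cs t).
Qed.

Lemma discrete_map2_continuous (T : topologicalType) (A B C : choiceType)
    (op : A -> B -> C) (f : T -> discrete_topology A)
    (g : T -> discrete_topology B) :
  continuous f -> continuous g ->
  continuous ((fun t => op (f t) (g t)) : T -> discrete_topology C).
Proof.
move=> cf cg t; apply/discrete_cvg.
have ft : nbhs t (f @^-1` [set f t]) by exact: cf (discrete_set1 _).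
have gt : nbhs t (g @^-1` [set g t]) by exact: cg (discrete_set1 _).
by apply: filterS2 ft gt => u /= -> ->.
Qed.

Definition transformation_groupoid : topgpd.
Proof.
apply: (@TopGpd X tarrows tsrc ttgt tid tinv tcomp).
- exact: tsrc_continuous.
- exact: ttgt_continuous.
- apply: tarr_continuous => x; first exact: cvg_cst.
  exact: cvg_id.
- apply: tarr_continuous => //=; last exact: ttgt_continuous.
  exact: (discrete_map2_continuous (op := fun g _ => g^-1)
            tgrp_continuous tgrp_continuous).
- set P := [set p | _].
  have c1 : continuous (fun p : P => (set_val p).1).
    move=> p; apply: (@continuous_comp P _ _ set_val fst); last exact: cvg_fst.
    exact: initial_continuous.
  have c2 : continuous (fun p : P => (set_val p).2).
    move=> p; apply: (@continuous_comp P _ _ set_val snd); last exact: cvg_snd.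
    exact: initial_continuous.
  apply: tarr_continuous => /=.
    exact: (discrete_map2_continuous (op := fun g h : G => g * h)
              (tgrp_comp_continuous c1) (tgrp_comp_continuous c2)).
  exact: tsrc_comp_continuous c2.
- by [].
- by move=> x; exact: pact1.
- by [].
- by move=> c; exact: pactK (tarrP c).
- by [].
- move=> c d e; rewrite /ttgt /=; set h := tgrp _; set y := tsrc _.
  have -> : h = tgrp c * tgrp d by [].
  have -> : y = tsrc d by [].
  rewrite e pactM //; first exact: tarrP.
  by apply: pact_domMr; [exact: tarrP|rewrite -/(ttgt d) -e; exact: tarrP].
- by move=> c d f *; apply: tarr_eq => //; exact: mulgA.
- by move=> c e; apply: tarr_eq => //; exact: mul1g.
- by move=> c e; apply: tarr_eq => //; exact: mulg1.
- by move=> c e; apply: tarr_eq => //; exact: mulVg.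
- by move=> c e; apply: tarr_eq => //; exact: mulgV.
Defined.

Definition stab (x : X) : set G := [set g | U g^-1 x /\ g .: x = x].

Definition stab_ess (x : X) : set G := [set g | \forall y \near x, stab y g].

End transformation_groupoid.

Section orbit_morphisms.
Context (G H : groupType) (X Y : topologicalType).
Context (act : partial_action G X) (act' : partial_action H Y).

Definition cocycle (a : tarrows act -> H) : Prop :=
  forall g1 g2 x (U2 : pdom act g2^-1 x) (U12 : pdom act (g1 * g2)^-1 x),
    a (tarr U12) = a (tarr (pact_domM U2 U12)) * a (tarr U2).

Definition orbit_equivariant (phi : X -> Y) (a : tarrows act -> H) : Prop :=
  forall c, pdom act' (a c)^-1 (phi (tsrc c)) /\
    phi (ttgt c) = pact act' (a c) (phi (tsrc c)).

Record orbit_morphism := OrbitMorphism {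
  om_map : X -> Y;
  om_coc : tarrows act -> discrete_topology H;
  om_map_continuous : continuous om_map;
  om_coc_continuous : continuous om_coc;
  om_cocycle : cocycle om_coc;
  om_equivariant : orbit_equivariant om_map om_coc
}.

Lemma orbit_morphism_eq (f f' : orbit_morphism) :
  om_map f = om_map f' -> om_coc f = om_coc f' -> f = f'.
Proof.
case: f f' => [p a ? ? ? ?] [p' a' ? ? ? ?] /= ep ea; subst p' a'.
by congr OrbitMorphism; exact: Prop_irrelevance.
Qed.

(* [a] is only defined on the arrows, so that a(.,x) restricted to S is encoded
   as [a] restricted to the arrows (g, x) with g in S. *)
Definition restricts_to_bij (a : tarrows act -> H) (x : X)
    (S : set G) (S' : set H) : Prop :=
  set_bij [set c | tsrc c = x /\ S (tgrp c)] S' a.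

Definition preserves_stab (phi : X -> Y) (a : tarrows act -> H) : Prop :=
  forall x, restricts_to_bij a x (stab act x) (stab act' (phi x)).

Definition preserves_stab_ess (phi : X -> Y) (a : tarrows act -> H) : Prop :=
  forall x, restricts_to_bij a x (stab_ess act x) (stab_ess act' (phi x)).

End orbit_morphisms.

Arguments cocycle {G H X act} a.

(* Continuous orbit equivalences; [coe_inv] is the inverse of the homeomorphism
   [coe_map]. *)
Record coe (G H : groupType) (X Y : topologicalType)
    (act : partial_action G X) (act' : partial_action H Y) := Coe {
  coe_map : X -> Y;
  coe_inv : Y -> X;
  coe_a : tarrows act -> discrete_topology H;
  coe_b : tarrows act' -> discrete_topology G;
  coe_mapK : cancel coe_map coe_inv;
  coe_invK : cancel coe_inv coe_map;
  coe_map_continuous : continuous coe_map;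
  coe_inv_continuous : continuous coe_inv;
  coe_a_continuous : continuous coe_a;
  coe_b_continuous : continuous coe_b;
  coe_a_equivariant : orbit_equivariant act' coe_map coe_a;
  coe_b_equivariant : orbit_equivariant act coe_inv coe_b
}.

Record pdynsys := PDynSys {
  pgrp : groupType;
  pspc : topologicalType;
  pgrp_countable : countable [set: pgrp];
  pspc_locally_compact : locally_compact [set: pspc];
  pspc_hausdorff : hausdorff_space pspc;
  pspc_second_countable : @second_countable pspc;
  pds_act :> partial_action pgrp pspc
}.

Definition orbit_id (A : pdynsys) : orbit_morphism A A.
Proof.
apply: (@OrbitMorphism _ _ _ _ A A id (@tgrp _ _ A)).
- by move=> x; exact: cvg_id.
- exact: tgrp_continuous.
- by [].
- by move=> c; split=> //; exact: tarrP.
Defined.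

Section comp.
Context (A B C : pdynsys).
Context (f' : orbit_morphism B C) (f : orbit_morphism A B).

(* the arrow (a(g,x), phi(x)) of the target, for an arrow (g,x) of the source *)
Definition orbit_arr (c : tarrows A) : tarrows B :=
  tarr (om_equivariant f c).1.

Definition orbit_comp : orbit_morphism A C.
Proof.
apply: (@OrbitMorphism _ _ _ _ A C (om_map f' \o om_map f)
          (om_coc f' \o orbit_arr)).
- by move=> x; apply: continuous_comp; exact: om_map_continuous.
- have co : continuous orbit_arr.
    apply: tarr_continuous; first exact: om_coc_continuous.
    move=> c; apply: (@continuous_comp _ _ _ (@tsrc _ _ A) (om_map f)).
      exact: tsrc_continuous.
    exact: om_map_continuous.
  by move=> c; apply: continuous_comp; [exact: co|exact: om_coc_continuous].
- move=> g1 g2 x U2 U12 /=.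
  have e2 := (om_equivariant f (tarr U2)).1.
  have e12 : pdom B (om_coc f (tarr (pact_domM U2 U12)) *
                     om_coc f (tarr U2))^-1 (om_map f x).
    by rewrite -om_cocycle; exact: (om_equivariant f (tarr U12)).1.
  have -> : orbit_arr (tarr U12) = tarr e12.
    by apply: tarr_eq => //; exact: om_cocycle.
  rewrite (om_cocycle f' e2 e12); congr (om_coc f' _ * om_coc f' _).
    apply: tarr_eq => //; rewrite /tsrc !set_valE /=.
    exact/esym/(om_equivariant f (tarr U2)).2.
  exact: tarr_eq.
- move=> c; have [Uc ec] := om_equivariant f' (orbit_arr c); split => //=.
  by rewrite (om_equivariant f c).2; exact: ec.
Defined.
End comp.

Definition PDynSysOrb : category.
Proof.
apply: (@Category pdynsys
  (fun A B => orbit_morphism A B) orbit_id orbit_comp).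
- by move=> A B f; apply: orbit_morphism_eq.
- move=> A B f; apply: orbit_morphism_eq => //; apply/funext => c /=.
  by congr om_coc; exact: tarr_eq.
- move=> A B C D f g h; apply: orbit_morphism_eq => //; apply/funext => c /=.
  by congr om_coc; exact: tarr_eq.
Defined.

(* Main.v *)
Require Import Defs.
From mathcomp Require Import all_boot all_classical topology.

(** Throughout, an arrow [(g, x)] of [G |x X] is sent by [(phi, a)] to
    [(a(g, x), phi(x))]; this is [orbit_arr].  The cocycle identity for [a] says
    exactly that this map is multiplicative ([cocycleP]), so orbit morphisms are
    the same thing as continuous functors between transformation groupoids, and
    an isomorphism on one side gives one on the other
    ([orbit_iso_groupoid_iso]).

    A groupoid isomorphism restricts to a bijection of isotropy groups, and the
    isotropy at [x] is [Stab(x)]; the group components of the two inverse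
    functors are therefore the two maps of a continuous orbit equivalence which
    preserves stabilisers ([groupoid_iso_coe]).

    The remaining arguments rest on one remark: a continuous map from arrows to
    a discrete group is locally constant along each slice [{g} x U_{g^-1}]
    ([continuous_tarrP]).  Hence a relation [k.x = x] derived from equivariance
    at [x] can be derived at every [y] near [x] with the same group elements,
    which is what membership of [k] in [Stab^ess(x)] asks for.  In this way
    stabiliser preservation passes to essential stabilisers
    ([preserves_stab_stab_ess]).

    Conversely, let [(phi, a, b)] preserve essential stabilisers, with [a] a
    cocycle.  If [c] and [d] are two arrows with the same image, then [c^-1 d]
    is essentially stabilising and is killed by [a], so it is a unit:
    [orbit_arr] is injective ([orbit_arr_inj]).  Given an arrow [d] of
    [H |x Y], the map [b] provides an arrow [c0] whose image has the same source
    and target as [d]; the discrepancy between that image and [d] is an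
    essential stabiliser, so it comes from an essential stabiliser [l] at the
    source of [c0], and [c0 l] is sent to [d]: [orbit_arr] is surjective
    ([orbit_arr_surj]).  The inverse of [orbit_arr], rather than [b] itself,
    supplies the cocycle of the inverse orbit morphism ([orbit_arr_bij_iso]). *)

Set Implicit Arguments.
Unset Strict Implicit.
Unset Printing Implicit Defensive.

Local Open Scope classical_set_scope.
Local Open Scope group_scope.

(** * Arrows, locally constant maps and cocycles *)

Section arrows.
Context (G : groupType) (X : topologicalType) (act : partial_action G X).
Local Notation U := (pdom act).
Local Notation GX := (transformation_groupoid act).

Lemma tarrK (c : tarrows act) : tarr (tarrP c) = c.
Proof. exact: tarr_eq. Qed.

Lemma near_pdom g x : U g x -> \forall y \near x, U g y.
Proof. by move=> Ux; apply: open_nbhs_nbhs; split=> //; exact: pdom_open. Qed.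

(** The arrow space is the disjoint union of the open slices
    [{g} x U_{g^-1}], so continuity into a discrete space amounts to local
    constancy along each slice.  The quantification over proofs [Uy] inside the
    neighborhood filter leaves the domain condition to be supplied separately by
    [near_pdom]. *)
Lemma continuous_tarrP (K : choiceType)
    (a : tarrows act -> discrete_topology K) :
  continuous a <->
  forall g x (Ux : U g^-1 x),
    \forall y \near x, forall Uy : U g^-1 y, a (tarr Uy) = a (tarr Ux).
Proof.
split=> [ca g x Ux | na c].
  have [_ [[W Wo <-] /= Wc WS]] : nbhs (tarr Ux) (a @^-1` [set a (tarr Ux)]).
    exact: ca (discrete_set1 _).
  pose i y : discrete_topology G * X := (g, y).
  have ci : {for x, continuous i}.
    exact: cvg_pair (cvg_cst _) cvg_id.
  have : \forall y \near x, W (i y).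
    by apply: ci; apply: open_nbhs_nbhs; split.
  by apply: filterS => y Wy Uy; exact: WS.
apply/discrete_cvg.
  by apply: (@fmap_filter _ _ a (nbhs c)); apply: nbhs_filter.
apply: filterS2 (tgrp_near c) (tsrc_continuous (na _ _ (tarrP c))) => d /=.
rewrite tarrK => gd na_d.
have Ud : U (tgrp c)^-1 (tsrc d) by rewrite -gd; exact: tarrP.
by rewrite -(na_d Ud); congr a; exact: tarr_eq.
Qed.

(** Identifies the stabiliser of [x] with the isotropy group at [x]. *)
Lemma stab_tarr x (c : tarrows act) :
  tsrc c = x -> stab act x (tgrp c) <-> ttgt c = x.
Proof.
by move=> <-; split=> [[]|tc] //; split=> //; exact: tarrP.
Qed.

Lemma stab_essW x g : stab_ess act x g -> stab act x g.
Proof. exact: nbhs_singleton. Qed.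

Lemma stab_ess1 x : stab_ess act x 1.
Proof. by apply: nearW => y; split; [exact: pact_dom1|exact: pact1]. Qed.

(** The cocycle identity is stated on triples [(g1, g2, x)] for which [g2.x] and
    [(g1 g2).x] are defined; by the axioms of partial actions these triples are
    exactly the composable pairs of arrows. *)
Lemma cocycleP (H : groupType) (a : tarrows act -> H) :
  cocycle a <->
  forall (c d : tarrows act) (e : tsrc c = ttgt d),
    a (@gmul GX c d e) = a c * a d.
Proof.
split=> [ca c d e|ca g1 g2 x U2 U12].
  have U12 : U (tgrp c * tgrp d)^-1 (tsrc d) := tarrP (@gmul GX c d e).
  rewrite [LHS](_ : _ = a (tarr U12)); last by congr a; exact: tarr_eq.
  rewrite (ca _ _ _ (tarrP d) U12) tarrK; congr (a _ * _).
  by apply: tarr_eq => //; rewrite e.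
by rewrite -ca //; congr a; exact: tarr_eq.
Qed.

Lemma cocycle_tid (H : groupType) (a : tarrows act -> H) x :
  cocycle a -> a (tid act x) = 1.
Proof.
move=> /cocycleP ca.
have e : tsrc (tid act x) = ttgt (tid act x) by rewrite [RHS]pact1.
apply: (mulgI (a (tid act x))); rewrite mulg1 -(ca _ _ e); congr a.
by apply: tarr_eq => //; exact: mulg1.
Qed.

End arrows.

(** * Orbit morphisms and functors *)

Section functors.
Context (A B : pdynsys).
Local Notation GA := (transformation_groupoid A).
Local Notation GB := (transformation_groupoid B).

Lemma ttgt_orbit_arr (f : orbit_morphism A B) c :
  ttgt (orbit_arr f c) = om_map f (ttgt c).
Proof. by rewrite (om_equivariant f c).2. Qed.

Lemma orbit_arr_continuous (f : orbit_morphism A B) :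
  continuous (orbit_arr f).
Proof.
apply: tarr_continuous; first exact: om_coc_continuous.
move=> c; apply: (@continuous_comp _ _ _ (@tsrc _ _ A) (om_map f)).
  exact: tsrc_continuous.
exact: om_map_continuous.
Qed.

Lemma orbit_arr_mul (f : orbit_morphism A B) (c d : garr GA)
    (e : gsrc c = gtgt d)
    (e' : gsrc (orbit_arr f c : garr GB) = gtgt (orbit_arr f d : garr GB)) :
  orbit_arr f (gmul e) = gmul e'.
Proof. by apply: tarr_eq => //; exact: (cocycleP _).1 (om_cocycle f) _ _ e. Qed.

Definition orbit_functor (f : orbit_morphism A B) : gpd_functor GA GB :=
  @GpdFunctor GA GB (om_map f) (orbit_arr f) (@om_map_continuous _ _ _ _ _ _ f)
    (@orbit_arr_continuous f) (fun=> erefl) (ttgt_orbit_arr f)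
    (@orbit_arr_mul f).

Lemma functor_cocycle (F : gpd_functor GA GB) :
  cocycle (@tgrp _ _ B \o fun_arr F).
Proof.
apply/cocycleP => c d e /=.
have e' : gsrc (fun_arr F c) = gtgt (fun_arr F d).
  by rewrite fun_src fun_tgt; congr fun_ob.
by rewrite (@fun_mul _ _ F c d e e').
Qed.

Lemma functor_continuous (F : gpd_functor GA GB) :
  continuous (@tgrp _ _ B \o fun_arr F : _ -> discrete_topology (pgrp B)).
Proof. exact: tgrp_comp_continuous (@fun_arr_continuous _ _ F). Qed.

Lemma functor_equivariant (F : gpd_functor GA GB) :
  orbit_equivariant B (fun_ob F : pspc A -> pspc B) (@tgrp _ _ B \o fun_arr F).
Proof.
move=> c; have sc : tsrc (fun_arr F c) = fun_ob F (tsrc c) := fun_src F c.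
have tc : ttgt (fun_arr F c) = fun_ob F (ttgt c) := fun_tgt F c.
by split; rewrite /= -sc -?tc //; exact: tarrP.
Qed.

End functors.

Lemma orbit_functor_id (A : pdynsys) :
  orbit_functor (Defs.orbit_id A) = gpd_functor_id _.
Proof. by apply: gpd_functor_eq => //; apply/funext => c; exact: tarr_eq. Qed.

Lemma orbit_functor_comp (A B C : pdynsys) (f' : orbit_morphism B C)
    (f : orbit_morphism A B) :
  orbit_functor (orbit_comp f' f) =
  gpd_functor_comp (orbit_functor f') (orbit_functor f).
Proof. by apply: gpd_functor_eq => //; apply/funext => c; exact: tarr_eq. Qed.

Lemma orbit_iso_groupoid_iso (A B : pdynsys) :
  @isomorphic PDynSysOrb A B ->
  @isomorphic TopGpdCat (transformation_groupoid A) (transformation_groupoid B).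
Proof.
move=> [f [g [gf fg]]]; exists (orbit_functor f), (orbit_functor g).
split.
- have /= := congr1 (@orbit_functor A A) gf.
  by rewrite orbit_functor_comp orbit_functor_id.
- have /= := congr1 (@orbit_functor B B) fg.
  by rewrite orbit_functor_comp orbit_functor_id.
Qed.

(** For an arrow with source [x], being in the stabiliser means having target
    [x], and a functor which is bijective on objects and arrows preserves and
    reflects this. *)
Lemma groupoid_iso_coe (A B : pdynsys) :
  @isomorphic TopGpdCat (transformation_groupoid A)
    (transformation_groupoid B) ->
  exists c : coe A B, cocycle (coe_a c) /\
    preserves_stab B (coe_map c) (coe_a c).
Proof.
move=> [F [F' [F'F FF']]].
have obK : cancel (fun_ob F) (fun_ob F').
  by move=> x; exact: (congr1 (fun E => fun_ob E x) F'F).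
have obK' : cancel (fun_ob F') (fun_ob F).
  by move=> y; exact: (congr1 (fun E => fun_ob E y) FF').
have arK : cancel (fun_arr F) (fun_arr F').
  by move=> c; exact: (congr1 (fun E => fun_arr E c) F'F).
have arK' : cancel (fun_arr F') (fun_arr F).
  by move=> d; exact: (congr1 (fun E => fun_arr E d) FF').
exists (@Coe _ _ _ _ A B _ _ _ _ obK obK'
  (@fun_ob_continuous _ _ F) (@fun_ob_continuous _ _ F')
  (@functor_continuous _ _ F) (@functor_continuous _ _ F')
  (@functor_equivariant _ _ F) (@functor_equivariant _ _ F')) => /=.
split; first exact: functor_cocycle.
have src c : tsrc (fun_arr F c) = fun_ob F (tsrc c) := fun_src F c.
have tgt c : ttgt (fun_arr F c) = fun_ob F (ttgt c) := fun_tgt F c.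
move=> x; split.
- move=> c [sc /(stab_tarr sc) tc]; apply/stab_tarr; first by rewrite src sc.
  by rewrite tgt tc.
- move=> c d; rewrite !inE => -[sc _] [sd _] cd.
  by apply: (can_inj arK); apply: tarr_eq => //; rewrite !src sc sd.
- move=> h [Uh hx]; exists (fun_arr F' (tarr Uh)); last by rewrite /= arK'.
  have sc : tsrc (fun_arr F' (tarr Uh)) = x.
    by apply: (can_inj obK); rewrite -src arK'.
  split=> //; apply/(stab_tarr sc).
  by apply: (can_inj obK); rewrite -tgt arK' /ttgt.
Qed.

(** * Essential stabilisers *)

(** Let [g] be in [Stab(x)].  Near [x] the value [a(g, y)] is a constant [h],
    and by equivariance and injectivity of [phi], [g] fixes [y] if and only if
    [h] fixes [phi(y)].  Since [phi] is a homeomorphism, [g] is an essential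
    stabiliser at [x] if and only if [h] is one at [phi(x)]. *)
Lemma preserves_stab_stab_ess (G H : groupType) (X Y : topologicalType)
    (act : partial_action G X) (act' : partial_action H Y)
    (phi : X -> Y) (psi : Y -> X) (a : tarrows act -> discrete_topology H) :
  cancel phi psi -> cancel psi phi -> continuous phi -> continuous psi ->
  continuous a -> orbit_equivariant act' phi a ->
  preserves_stab act' phi a -> preserves_stab_ess act' phi a.
Proof.
move=> phiK psiK cphi cpsi /continuous_tarrP ca eqv st x.
have [fst inj sur] := st x; split.
- move=> c [<- ess].
  have nx : \forall y \near tsrc c, stab act' (phi y) (a c).
    apply: filterS2 ess (ca _ _ (tarrP c)) => y [Uy gy].
    rewrite tarrK => /(_ Uy) <-.
    have [fsty _ _] := st y; exact: (fsty (tarr Uy)).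
  have := cpsi (phi (tsrc c)); rewrite /continuous_at phiK => /(_ _ nx).
  by apply: (@filterS _ (nbhs (phi (tsrc c)))) => z /=; rewrite psiK.
- move=> c d; rewrite !inE => -[sc ec] [sd ed].
  by apply: inj; rewrite inE; split=> //; exact: stab_essW.
- move=> h ess; have [c [sc stc] ah] := sur _ (stab_essW ess).
  exists c => //; split=> //; subst x.
  have nh : \forall y \near tsrc c, stab act' (phi y) h := cphi _ _ ess.
  apply: filterS3 nh (near_pdom (tarrP c)) (ca _ _ (tarrP c)).
  move=> y [Vy hy] Uy; rewrite tarrK => /(_ Uy) ay; split=> //.
  apply: (can_inj phiK); have [_ /= E] := eqv (tarr Uy).
  by rewrite -[LHS]/(phi (ttgt (tarr Uy))) E ay ah.
Qed.

Section essential.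
Context (A B : pdynsys) (f : orbit_morphism A B).
Context (ess : preserves_stab_ess B (om_map f) (om_coc f)).
Local Notation GA := (transformation_groupoid A).
Local Notation phi := (om_map f).
Local Notation a := (om_coc f).

(** Two arrows [c], [d] with the same image have the same source and target.
    Keeping the group components and moving the source to a nearby point does
    not change the values of [a], so [c^-1 d] lies in the essential stabiliser.
    Since [a] takes the value [1] there, as at the unit, injectivity of [a] on
    the essential stabiliser forces [c = d]. *)
Lemma orbit_arr_inj : injective phi -> injective (orbit_arr f).
Proof.
move=> phi_inj c d cd.
have sE : tsrc c = tsrc d by apply: phi_inj; exact: (congr1 (@tsrc _ _ B) cd).
have aE : a c = a d := congr1 (@tgrp _ _ B) cd.
have tE : ttgt c = ttgt d by apply: phi_inj; rewrite -!ttgt_orbit_arr cd.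
have e : tsrc (tinv c) = ttgt d by rewrite -tE.
pose k : tarrows A := @gmul GA (tinv c) d e.
have ca := (cocycleP a).1 (om_cocycle f).
have ak : a k = 1.
  have e' : tsrc (tinv c) = ttgt c by [].
  rewrite [LHS]ca -aE -(ca _ _ e') -(cocycle_tid (tsrc c) (om_cocycle f)).
  by congr a; apply: tarr_eq => //; exact: mulVg.
have kess : stab_ess A (tsrc d) (tgrp k).
  have /continuous_tarrP la := @om_coc_continuous _ _ _ _ _ _ f.
  have Uc : pdom A (tgrp c)^-1 (tsrc d) by rewrite -sE; exact: tarrP.
  have cE : c = tarr Uc by exact: tarr_eq.
  near=> y.
  have Ucy : pdom A (tgrp c)^-1 y by near: y; exact: near_pdom.
  have Udy : pdom A (tgrp d)^-1 y by near: y; exact: near_pdom (tarrP d).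
  have ac : a (tarr Ucy) = a c.
    by rewrite [in RHS]cE; move: Ucy; near: y; exact: la.
  have ad : a (tarr Udy) = a d.
    by rewrite -[in RHS](tarrK d); move: Udy; near: y; exact: la.
  have gy : pact A (tgrp d) y = pact A (tgrp c) y.
    apply: phi_inj.
    rewrite -[LHS]/(phi (ttgt (tarr Udy))) -[RHS]/(phi (ttgt (tarr Ucy))).
    by rewrite (om_equivariant f _).2 ad -aE -ac -(om_equivariant f _).2.
  (* [k] is, over [y], the product of an arrow with the inverse of a parallel
     one, hence it fixes [y]. *)
  have ey : tsrc (tinv (tarr Ucy)) = ttgt (tarr Udy) by rewrite [RHS]gy.
  have sk : tsrc (@gmul GA _ _ ey) = y by [].
  apply: ((stab_tarr sk).2); rewrite [LHS](@gtgt_mul GA _ _ ey).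
  exact: pactK.
have [_ inj _] := ess (tsrc d).
have : k = tid A (tsrc d).
  apply: inj; rewrite ?inE; [by split|split=> //; exact: stab_ess1|].
  by rewrite ak cocycle_tid //; exact: om_cocycle.
move=> /(congr1 (@tgrp _ _ A)) k1.
apply: tarr_eq => //; apply: (mulgI (tgrp c)^-1); rewrite mulVg.
exact/esym.
Unshelve. all: by end_near.
Qed.

(** With [c0 = (b(d), psi(s(d)))], the arrow [orbit_arr f c0] is parallel to
    [d].  Since [a] and [b] are locally constant, the two arrows stay parallel
    when the source moves, so [(orbit_arr f c0)^-1 d] lies in the essential
    stabiliser and lifts to some [l]; then [c0 l] is a preimage of [d]. *)
Lemma orbit_arr_surj (psi : pspc B -> pspc A)
    (b : tarrows B -> discrete_topology (pgrp A)) :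
  cancel phi psi -> cancel psi phi -> continuous psi ->
  continuous b -> orbit_equivariant A psi b ->
  forall d, exists c, orbit_arr f c = d.
Proof.
move=> phiK psiK cpsi /continuous_tarrP lb eqb d.
have /continuous_tarrP la := @om_coc_continuous _ _ _ _ _ _ f.
have [U0 t0] := eqb d; pose c0 := tarr U0.
have e : tsrc (tinv (orbit_arr f c0)) = ttgt d.
  by rewrite [LHS]ttgt_orbit_arr /ttgt -t0 psiK.
(* The discrepancy between [d] and the first guess [orbit_arr f c0]. *)
pose k : tarrows B := @gmul (transformation_groupoid B) _ _ e.
have kess : stab_ess B (phi (psi (tsrc d))) (tgrp k).
  rewrite psiK; near=> y.
  have Vy : pdom B (tgrp d)^-1 y by near: y; exact: near_pdom (tarrP d).
  have bVy : b (tarr Vy) = b d.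
    by rewrite -[in RHS](tarrK d); move: Vy; near: y; exact: lb.
  have [Uy ty] := eqb (tarr Vy); rewrite bVy -[tsrc (tarr Vy)]/y in Uy ty.
  have ay : a (tarr Uy) = a c0.
    by move: Uy; near: y; exact: (cpsi _ _ (la _ _ U0)).
  have [/= Wy wy] := om_equivariant f (tarr Uy).
  rewrite ay /= psiK in Wy wy.
  rewrite -[ttgt (tarr Uy)]/(pact A (b d) (psi y)) -ty psiK in wy.
  have ey : tsrc (tinv (tarr Wy)) = ttgt (tarr Vy) by exact/esym.
  have sk : tsrc (@gmul (transformation_groupoid B) _ _ ey) = y by [].
  apply: ((stab_tarr sk).2).
  rewrite [LHS](@gtgt_mul (transformation_groupoid B) _ _ ey).
  exact: pactK.
have [_ _ sur] := ess (psi (tsrc d)).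
have [l [sl lst] al] := sur _ kess.
have tl : tsrc c0 = ttgt l by rewrite ((stab_tarr sl).1 (stab_essW lst)).
exists (@gmul GA c0 l tl); apply: tarr_eq; last by rewrite -[RHS]psiK -sl.
rewrite [LHS]((cocycleP a).1 (om_cocycle f)) al.
exact: mulVKg.
Unshelve. all: by end_near.
Qed.

End essential.

(** * Inverse orbit morphisms *)

(** The inverse of [orbit_arr f] on arrows is multiplicative because
    [orbit_arr f] is.  Its group component is locally constant: if [(g, psi(y))]
    is the preimage of [(h, y)], then for [z] near [y] the arrow [(g, psi(z))]
    is sent to [(h, z)], by local constancy of the cocycle, so [g] is also the
    group component of the preimage of [(h, z)]. *)
Lemma orbit_arr_bij_iso (A B : pdynsys) (f : orbit_morphism A B)
    (psi : pspc B -> pspc A) :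
  cancel (om_map f) psi -> cancel psi (om_map f) -> continuous psi ->
  injective (orbit_arr f) -> (forall d, exists c, orbit_arr f c = d) ->
  @isomorphic PDynSysOrb A B.
Proof.
move=> phiK psiK cpsi inj /choice[q qK].
have fK : cancel (orbit_arr f) q by move=> c; apply: inj; rewrite qK.
have src d : tsrc (q d) = psi (tsrc d).
  by apply: (can_inj phiK); rewrite psiK -[in RHS](qK d).
have tgt d : ttgt (q d) = psi (ttgt d).
  by apply: (can_inj phiK); rewrite psiK -ttgt_orbit_arr qK.
have coc : cocycle (@tgrp _ _ A \o q).
  apply/cocycleP => c d e /=.
  have e' : tsrc (q c) = ttgt (q d) by rewrite src tgt e.
  rewrite (_ : q _ = @gmul (transformation_groupoid A) _ _ e') //.
  apply: inj; rewrite qK; apply: tarr_eq.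
    rewrite [RHS]((cocycleP _).1 (om_cocycle f)).
    by rewrite -[om_coc f _]/(tgrp (orbit_arr f (q c)))
      -[om_coc f (q d)]/(tgrp (orbit_arr f (q d))) !qK.
  by rewrite -[RHS]/(om_map f (tsrc (q d))) src psiK.
have eqv : orbit_equivariant A psi (@tgrp _ _ A \o q).
  by move=> d; split; rewrite /= -src -?tgt //; exact: tarrP.
have cq : continuous (@tgrp _ _ A \o q : _ -> discrete_topology (pgrp A)).
  apply/continuous_tarrP => h y Vy.
  have /continuous_tarrP la := @om_coc_continuous _ _ _ _ _ _ f.
  have Uq : pdom A (tgrp (q (tarr Vy)))^-1 (psi y).
    by have := tarrP (q (tarr Vy)); rewrite src.
  have qE : q (tarr Vy) = tarr Uq by apply: tarr_eq => //; exact: src.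
  near=> z => Vz /=.
  have Uz : pdom A (tgrp (q (tarr Vy)))^-1 (psi z).
    by near: z; exact: (cpsi _ _ (near_pdom Uq)).
  have az : om_coc f (tarr Uz) = om_coc f (tarr Uq).
    by move: Uz; near: z; exact: (cpsi _ _ (la _ _ Uq)).
  rewrite -[in LHS](_ : orbit_arr f (tarr Uz) = tarr Vz).
    by rewrite fK.
  apply: tarr_eq; last exact: psiK.
  rewrite -[LHS]/(om_coc f (tarr Uz)) az -qE.
  by rewrite -[LHS]/(tgrp (orbit_arr f (q (tarr Vy)))) qK.
exists f, (@OrbitMorphism _ _ _ _ B A psi _ cpsi cq coc eqv).
split; apply: orbit_morphism_eq => /=; apply/funext => c /=.
- exact: phiK.
- by rewrite fK.
- exact: psiK.
- rewrite -[in RHS](qK c); congr om_coc.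
  by apply: tarr_eq => //; rewrite src.
Unshelve. all: by end_near.
Qed.

Lemma coe_stab_ess_iso (A B : pdynsys) (c : coe A B) :
  cocycle (coe_a c) -> preserves_stab_ess B (coe_map c) (coe_a c) ->
  @isomorphic PDynSysOrb A B.
Proof.
move=> coc ess.
pose f : orbit_morphism A B := OrbitMorphism (@coe_map_continuous _ _ _ _ _ _ c)
  (@coe_a_continuous _ _ _ _ _ _ c) coc (@coe_a_equivariant _ _ _ _ _ _ c).
have phiK := @coe_mapK _ _ _ _ _ _ c; have psiK := @coe_invK _ _ _ _ _ _ c.
have cpsi := @coe_inv_continuous _ _ _ _ _ _ c.
apply: (@orbit_arr_bij_iso _ _ f (coe_inv c)) => //.
- exact: (@orbit_arr_inj _ _ f ess (can_inj phiK)).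
- apply: (@orbit_arr_surj _ _ f ess (coe_inv c) (coe_b c)) => //.
    exact: coe_b_continuous.
  exact: coe_b_equivariant.
Qed.

Theorem theorem3p13 (A B : pdynsys) :
  [<-> @isomorphic PDynSysOrb A B;
       @isomorphic TopGpdCat (transformation_groupoid A)
                             (transformation_groupoid B);
       exists c : coe A B, cocycle (coe_a c) /\
         preserves_stab B (coe_map c) (coe_a c);
       exists c : coe A B, cocycle (coe_a c) /\
         preserves_stab_ess B (coe_map c) (coe_a c)].
Proof.
tfae.
- exact: orbit_iso_groupoid_iso.
- exact: groupoid_iso_coe.
- move=> [c [coc st]]; exists c; split=> //.
  apply: (preserves_stab_stab_ess _ _ _ _ _ _ st).
  + exact: coe_mapK.
  + exact: coe_invK.
  + exact: coe_map_continuous.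
  + exact: coe_inv_continuous.
  + exact: coe_a_continuous.
  + exact: coe_a_equivariant.
- by move=> [c [coc ess]]; exact: coe_stab_ess_iso ess.
Qed.
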